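(* There exists an absolute constant $c>0$ such that for all positive integers $d$, $$\operatorname{herdisc}(\mathcal{S}^d) \;\geq\; c\, 2^{d/16},$$ where $\mathcal{S}^d$ is the set system of all subcubes of the boolean cube $\{0,1\}^d$.
   Context: For a positive integer $d$, the set system $\mathcal{S}^d = \{S_v\}_{v \in \{0,1,*\}^d}$ on the ground set $\{0,1\}^d$ is defined by $$S_v = \{u \in \{0,1\}^d : \text{for all } i,\ v_i \neq * \Rightarrow u_i = v_i\}.$$ For a finite set system $\mathcal{S} = \{S_1,\ldots,S_m\}$ of subsets of a finite ground set $U$, and $W \subseteq U$, the restriction is $\mathcal{S}|_W = \{S_1 \cap W, \ldots, S_m \cap W\}$, a set system on the ground set $W$. The discrepancy and hereditary discrepancy are $$\operatorname{disc}(\mathcal{S}) = \min_{f: U \to \{-1,+1\}} \max_{j \in \{1,\ldots,m\}} \Bigl|\sum_{i \in S_j} f(i)\Bigr|, \qquad \operatorname{herdisc}(\mathcal{S}) = \max_{W \subseteq U} \operatorname{disc}(\mathcal{S}|_W).$$ *)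

(* Defs.v *)
From HB Require Import structures.
From mathcomp Require Import all_boot all_order all_algebra.

Set Implicit Arguments.
Unset Strict Implicit.
Unset Printing Implicit Defensive.

Import Order.TTheory GRing.Theory Num.Theory.
Local Open Scope ring_scope.

(* A set system on the ground set U is a set of subsets of the finType U. *)
Section Discrepancy.
Variable U : finType.
Implicit Types (S : {set {set U}}) (W : {set U}).

(* f : U -> bool encodes the colouring i |-> (-1) ^+ f i, so that false is +1
   and true is -1. *)
Definition coloring_disc (f : {ffun U -> bool}) S : nat :=
  \max_(A in S) `|\sum_(i in A) (-1) ^+ f i : int|%N.

(* The arg min ranges over all colourings; the constant one is only the
   witness that there is at least one. *)
Definition disc S : nat :=
  coloring_disc [arg min_(f < [ffun=> false]) coloring_disc f S] S.

(* The ground set of the restriction is W itself, as a subtype of U, and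
   A :&: W becomes the preimage of A in that subtype. *)
Definition restrict S W : {set {set {x : U | x \in W}}} :=
  [set [set x : {x : U | x \in W} | val x \in A] | A : {set U} in S].

End Discrepancy.

Definition herdisc (U : finType) (S : {set {set U}}) : nat :=
  \max_(W : {set U}) disc (restrict S W).

Definition cube (d : nat) : finType := {ffun 'I_d -> bool}.

(* v i = None stands for v_i = *. *)
Definition subcube (d : nat) (v : {ffun 'I_d -> option bool}) : {set cube d} :=
  [set u : cube d | [forall i, (v i != None) ==> (Some (u i) == v i)]].

Definition subcubes (d : nat) : {set {set cube d}} :=
  [set subcube v | v : {ffun 'I_d -> option bool}].

(* Main.v *)
Require Import Defs.
From HB Require Import structures.
From mathcomp Require Import all_boot all_order all_algebra.
From mathcomp Require Import reals exp.
From mathcomp Require Import zify.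

Set Implicit Arguments.
Unset Strict Implicit.
Unset Printing Implicit Defensive.

Import Order.TTheory GRing.Theory Num.Theory.
Local Open Scope ring_scope.

(* This is the determinant lower bound, in a lattice-point form, for an explicit
   submatrix.  The three unit vectors of {0,1}^3 meet the subcubes u_i = 0 in
   the matrix J - I, of determinant 2; its m-th tensor power A, of order
   n = 3^m and determinant 2^(m n / 3), sits in the incidence matrix of the
   subcubes as soon as d >= 3 m.  If h bounds the hereditary discrepancy, binary
   rounding puts in every class mod 2^t of Z^n a vector x with
   |A x| <= h (2^t - 1).  Adding to A x the representatives r of Z^n modulo the
   column lattice gives distinct integer points of a cube, and counting them
   bounds h below by 2^(m/3), up to a constant factor. *)

(** * Colourings and binary rounding *)

Lemma herdisc_coloring (U : finType) (S : {set {set U}}) (W : {set U}) :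
  exists f : U -> bool, forall A, A \in S ->
    (`|\sum_(u in W | u \in A) (-1) ^+ f u : int| <= herdisc S)%N.
Proof.
have := leq_bigmax (F := fun W => disc (restrict S W)) W.
rewrite -/(herdisc S) /disc.
set f := [arg min_(_ < _) _] => le_f.
(* [f] colours only the subtype of [W]; it is extended to [U] by an arbitrary [false]. *)
pose fW u := if insub u is Some x then f x else false.
exists fW => A SA.
apply: leq_trans le_f; rewrite /coloring_disc.
set A' := [set x : {x : U | x \in W} | val x \in A].
have RA' : A' \in restrict S W by apply/imsetP; exists A.
apply: leq_trans (leq_bigmax_cond A' RA').
suff -> : \sum_(u in W | u \in A) (-1) ^+ fW u
  = \sum_(x in A') (-1) ^+ f x :> int by [].
have -> : \sum_(x in A') (-1) ^+ f x = \sum_(x in A') (-1) ^+ fW (val x) :> int.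
  by apply: eq_bigr => x _; rewrite /fW valK.
rewrite -(big_imset (h := val) (A := mem A') (fun u => (-1) ^+ fW u : int)) /=;
  last by move=> x y _ _ /val_inj.
apply: eq_bigl => u; apply/andP/imsetP => [[Wu Au]|[x]].
  by exists (Sub u Wu); rewrite ?inE ?SubK.
by rewrite inE => Ax ->; split => //; apply: valP.
Qed.

(* Binary rounding: a colouring of the set of odd coordinates of y makes y
   even, and y is then halved. *)
Lemma rounding (I U : finType) (A : I -> pred U) (h t : nat) :
  (forall W : {set U}, exists f : U -> bool, forall v,
     (`|\sum_(u in W | A v u) (-1) ^+ f u : int| <= h)%N) ->
  forall y : U -> int, exists x : U -> int,
    (forall u, (2 ^+ t %| x u - y u)%Z) /\
    forall v, (`|(\sum_(u | A v u) x u)%R| + h <= h * 2 ^ t)%N.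
Proof.
move=> colA; elim: t => [|t IHt] y.
  exists (fun=> 0); split=> [u|v]; first by rewrite dvd1z.
  by rewrite big1 // muln1.
pose W := [set u | odd `|y u|].
have [f Af] := colA W.
pose chi u : int := if u \in W then (-1) ^+ f u else 0.
have chi_half u : {z | y u = chi u + 2 * z}.
  exists ((y u - chi u) %/ 2)%Z; rewrite [2 * _]mulrC divzK ?subrKC //.
  rewrite dvdzE dvdn2 /chi inE.
  by case: ifP; case: (f u) => /=; rewrite ?expr1 ?expr0; lia.
(* Rounding the halved vector gives the bound [h + 2 h (2^t - 1) = h (2^(t+1) - 1)]. *)
have [x [xy Ax]] := IHt (fun u => sval (chi_half u)).
exists (fun u => chi u + 2 * x u); split=> [u|v].
  have := xy u; case: (chi_half u) => /= z {1}-> /dvdzP [q E].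
  apply/dvdzP; exists q; rewrite exprS; lia.
rewrite big_split /= -mulr_sumr.
have -> : \sum_(u | A v u) chi u = \sum_(u in W | A v u) (-1) ^+ f u.
  rewrite /chi -big_mkcondr; apply: eq_bigl => u; exact: andbC.
have := Af v; have := Ax v; rewrite expnS mulnCA.
by move: (\sum_(u | A v u) x u) (\sum_(u in W | A v u) _) (h * 2 ^ t)%N; lia.
Qed.

Lemma big_tupleS (R : Type) (idx : R) (op : Monoid.com_law idx) (T : finType)
    (m : nat) (P : pred (m.+1.-tuple T)) (F : m.+1.-tuple T -> R) :
  \big[op/idx]_(u | P u) F u =
  \big[op/idx]_(a : T)
    \big[op/idx]_(u : m.-tuple T | P [tuple of a :: u]) F [tuple of a :: u].
Proof.
rewrite pair_big_dep /=.
apply: (reindex (fun p : T * m.-tuple T => [tuple of p.1 :: p.2])).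
exists (fun u => (thead u, [tuple of behead u])) => [[a u] _|u _] /=.
  by congr pair; apply/val_inj.
by rewrite [RHS]tuple_eta; apply/val_inj.
Qed.

Lemma big_ord3 (R : Type) (idx : R) (op : Monoid.law idx) (F : 'I_3 -> R) :
  \big[op/idx]_(a < 3) F a = op (F 0) (op (F 1) (F 2)).
Proof.
rewrite !big_ord_recl big_ord0 Monoid.mulm1.
by congr (op _ (op _ _)); congr F; apply/val_inj.
Qed.

(** * The tensor power of [J - I]: its column lattice and the point count *)

Local Notation word m := (m.-tuple 'I_3).

(** The 0-1 matrix A: an entry of the tensor power is the product over the letters of the entries
    [a != b] of [J - I]. *)
Definition differ (m : nat) (v u : word m) : bool :=
  all2 (fun a b => a != b) v u.

Lemma differP m (v u : word m) :
  reflect (forall j, tnth v j != tnth u j) (differ v u).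
Proof.
rewrite /differ all2E !size_tuple eqxx /=.
apply: (iffP (all_nthP (0, 0))); rewrite size_zip !size_tuple minnn.
  move=> vu j; have := vu j (ltn_ord j).
  by rewrite nth_zip ?size_tuple // !(tnth_nth 0).
move=> vu j lt_j; rewrite nth_zip ?size_tuple //=.
by have := vu (Ordinal lt_j); rewrite !(tnth_nth 0).
Qed.

(* In lexicographic order, the lattice spanned by the columns of [differ] has a
   triangular basis with diagonal entries [2 ^ count_mem 2 v], so that its only
   vector with entries smaller than these is zero. *)
Lemma differ_reduced m (z : word m -> int) :
  (forall v,
     (`|(\sum_(u | differ v u) z u)%R| < 2 ^ count_mem (2%R : 'I_3) v)%N) ->
  forall u, z u = 0.
Proof.
elim: m z => [|m IHm] z small.
  move=> u; have := small [tuple]; rewrite (tuple0 u).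
  rewrite (big_pred1 [tuple]) => [|v]; first by rewrite /=; lia.
  by rewrite [v]tuple0 [RHS]eqxx.
pose zz (a : 'I_3) (u : word m) := z [tuple of a :: u].
have sumS a (v : word m) : \sum_(u | differ [tuple of a :: v] u) z u =
    \sum_(b | a != b) \sum_(u | differ v u) zz b u.
  rewrite big_tupleS big_mkcond [RHS]big_mkcond; apply: eq_bigr => b _ /=.
  by rewrite /differ /=; case: (a != b) => //=; rewrite big_pred0.
have sumD a b (v : word m) : \sum_(u | differ v u) (zz a u + zz b u) =
  \sum_(u | differ v u) zz a u + \sum_(u | differ v u) zz b u.
  by rewrite big_split.
have z12 u : zz 1 u + zz 2 u = 0.
  move: u; apply: IHm => v; have := small [tuple of (0 : 'I_3) :: v].
  by rewrite sumS big_mkcond big_ord3 /= add0r sumD.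
have z02 u : zz 0 u + zz 2 u = 0.
  move: u; apply: IHm => v; have := small [tuple of (1 : 'I_3) :: v].
  by rewrite sumS big_mkcond big_ord3 /= add0r sumD.
have z2 u : zz 2 u = 0.
  move: u; apply: IHm => v; have := small [tuple of (2%R : 'I_3) :: v].
  rewrite sumS big_mkcond big_ord3 /= addr0 -sumD.
  (* By [z12] and [z02]; the factor 2 cancels the one that the leading letter 2 adds to the
     bound. *)
  rewrite (eq_bigr (fun u => - 2 * zz 2 u)); last first.
    by move=> u _; have := z12 u; have := z02 u; lia.
  rewrite -mulr_sumr expnS.
  by move: (\sum_(u | _) _) (2 ^ _)%N; lia.
have zz0 a u : zz a u = 0.
  have := z12 u; have := z02 u; have := z2 u.
  have : [|| a == 0, a == 1 | a == 2] by case: a => [[|[|[|]]]].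
  by case/or3P => /eqP ->; lia.
by move=> u; rewrite [u]tuple_eta; apply: zz0.
Qed.

(** The exponent of the determinant of A: each letter fills one third of the [m * 3 ^ m] places. *)
Lemma sum_count m :
  (3 * \sum_(v : word m) count_mem (2%R : 'I_3) v = m * 3 ^ m)%N.
Proof.
elim: m => [|m IHm].
  by rewrite big1 // => v _; rewrite (tuple0 v).
rewrite big_tupleS big_ord3 /= !big_split /= !sum_nat_const.
rewrite card_tuple card_ord expnS.
by move: (\sum_v _)%N (3 ^ m)%N IHm; nia.
Qed.

(* The integer points A x_y + r, for y modulo 2^m and r a reduced vector, are
   pairwise distinct and lie in a cube of side 2^(g + m + 2). *)
Lemma differ_discrepancy m g :
  (forall W : {set word m}, exists f : word m -> bool, forall v,
     (`|\sum_(u in W | differ v u) (-1) ^+ f u : int| <= 2 ^ g)%N) ->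
  (m <= 3 * (g + 2))%N.
Proof.
move=> col.
have [x xP] := fin_all_exists (fun y : {ffun word m -> 'I_(2 ^ m)} =>
  rounding m col (fun u => (y u)%:Z)).
pose k (v : word m) := count_mem (2%R : 'I_3) v.
have k_le v : (k v <= m)%N by rewrite -[leqRHS](size_tuple v) count_size.
pose X := ({ffun word m -> 'I_(2 ^ m)} * {dffun forall v, 'I_(2 ^ k v)})%type.
pose N := (2 ^ (g + m + 2))%N.
(* The shift by [2 ^ (g + m)] makes the entries nonnegative, as [|A x| <= 2^g (2^m - 1)]. *)
pose val_ (p : X) v : int :=
  \sum_(u | differ v u) x p.1 u + (p.2 v)%:Z + (2 ^ (g + m))%N%:Z.
have val_ge0 p v : (0 <= val_ p v) && (`|val_ p v| < N)%N.
  have [_ /(_ v)] := xP p.1; have := ltn_ord (p.2 v).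
  have : (2 ^ k v <= 2 ^ m)%N by rewrite leq_exp2l.
  rewrite /val_ /N !expnD; have := expn_gt0 2 g.
  move: (\sum_(u | _) _) (nat_of_ord (p.2 v)) => s r.
  by move: (2 ^ g)%N (2 ^ m)%N (2 ^ k v)%N => G M K; nia.
have val_lt p v : (`|val_ p v| < N)%N by case/andP: (val_ge0 p v).
pose F (p : X) : {ffun word m -> 'I_N} := [ffun v => Ordinal (val_lt p v)].
have F_inj : injective F.
  move=> [y r] [y' r'] /ffunP eqF.
  have eq_val v : val_ (y, r) v = val_ (y', r') v.
    have := congr1 val (eqF v); rewrite !ffunE /=.
    by case/andP: (val_ge0 (y, r) v); case/andP: (val_ge0 (y', r') v); lia.
  (* [A (x y - x y') = r' - r] has entries below the diagonal ones, hence vanishes with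
     [x y - x y']. *)
  have eqx u : x y u - x y' u = 0.
    move: u; apply: differ_reduced => v.
    move: (ltn_ord (r v)) (ltn_ord (r' v)) (eq_val v).
    rewrite /val_ /= sumrB -/(k v).
    move: (\sum_(u | _) x y u) (\sum_(u | _) x y' u) => s s'.
    move: (nat_of_ord (r v)) (nat_of_ord (r' v)) (2 ^ (g + m))%N => a a' B.
    by move: (2 ^ k v)%N; lia.
  have eqy : y = y'.
    apply/ffunP => u; apply/val_inj => /=.
    have [/(_ u)/dvdzP[q Eq] _] := xP y; have [/(_ u)/dvdzP[q' Eq'] _] := xP y'.
    have := ltn_ord (y u); have := ltn_ord (y' u); have := eqx u; move: Eq Eq'.
    rewrite (_ : 2 ^+ m = (2 ^ m)%N%:Z); last by rewrite -natrX natz.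
    move: (nat_of_ord (y u)) (nat_of_ord (y' u)) (x y u) (x y' u) => a a' s s'.
    move: (2 ^ m)%N => M Eq Eq' ss' lt_a' lt_a.
    have e : a%:Z - a'%:Z = (q' - q) * M%:Z by rewrite mulrBl; lia.
    by case: (ltgtP q q') => qq'; nia.
  subst y'; congr pair; apply/ffunP => v; apply/val_inj.
  by have := eq_val v; rewrite /val_ /=; lia.
have := leq_card F F_inj.
rewrite card_prod !card_ffun !card_ord card_dep_ffun card_tuple card_ord.
rewrite foldrE big_map big_enum /=.
have -> : (\prod_(v : word m) #|'I_(2 ^ k v)| = 2 ^ \sum_(v : word m) k v)%N.
  by rewrite expn_sum; apply: eq_bigr => v _; rewrite card_ord.
rewrite -!expnM -expnD leq_exp2l //.
(* With [n = 3 ^ m], the count reads [m n + m n / 3 <= (g + m + 2) n]. *)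
rewrite -[(m <= _)%N](leq_pmul2r (_ : 0 < 3 ^ m)%N) ?expn_gt0 //.
move: (sum_count m); rewrite -/k.
by move: (\sum_v _)%N (3 ^ m)%N => s K; lia.
Qed.

(** * The matrix inside the subcube system *)

Section Embedding.
Variables m d : nat.
Hypothesis md : (3 * m <= d)%N.

Definition onehot (u : word m) : cube d :=
  [ffun i : 'I_d => (i %/ 3 < m)%N && (val (nth 0%R u (i %/ 3)) == i %% 3)%N].

Definition avoid (v : word m) : {ffun 'I_d -> option bool} :=
  [ffun i => if onehot v i then Some false else None].

Lemma slot_subproof (j : 'I_m) (a : 'I_3) : (3 * j + a < d)%N.
Proof. by have := ltn_ord j; have := ltn_ord a; lia. Qed.

Lemma onehotE u j a : onehot u (Ordinal (slot_subproof j a)) = (tnth u j == a).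
Proof.
rewrite ffunE /= mulnC divnMDl // modnMDl modn_small // divn_small // addn0.
by rewrite ltn_ord (tnth_nth 0).
Qed.

Lemma onehot_inj : injective onehot.
Proof.
move=> u u' e; apply: eq_from_tnth => j; apply/eqP; rewrite eq_sym.
by rewrite -(onehotE u' j) -e onehotE.
Qed.

(** [u] and [v] agree at place [j] exactly when [onehot u] is 1 at coordinate [3 j + v_j], which the
    subcube forces to 0. *)
Lemma onehot_avoid v u : (onehot u \in subcube (avoid v)) = differ v u.
Proof.
rewrite inE; apply/forallP/differP => [vu j|vu i].
  have := vu (Ordinal (slot_subproof j (tnth v j))).
  rewrite ffunE !onehotE eqxx /= [tnth v j == _]eq_sym.
  by case: (tnth u j == _).
rewrite [avoid v i]ffunE; case: ifP => //=.
rewrite !ffunE => /andP[lt_i /eqP e].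
rewrite lt_i /= -e; have := vu (Ordinal lt_i); rewrite !(tnth_nth 0) /=.
by rewrite eq_sym -val_eqE /=; case: (_ == _).
Qed.

Lemma herdisc_subcubes_gt g :
  (3 * (g + 2) < m)%N -> (2 ^ g < herdisc (subcubes d))%N.
Proof.
apply: contraLR; rewrite -leqNgt -leqNgt => le_g.
apply: differ_discrepancy => W.
have [f fP] := herdisc_coloring (subcubes d) (onehot @: W).
exists (f \o onehot) => v; apply: leq_trans le_g.
apply: leq_trans (fP (subcube (avoid v)) _); last exact: imset_f.
suff -> : \sum_(u in onehot @: W | u \in subcube (avoid v)) (-1) ^+ f u
  = \sum_(u in W | differ v u) (-1) ^+ (f \o onehot) u :> int by [].
rewrite big_mkcondr big_imset /=; last by move=> u u' _ _; apply: onehot_inj.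
by rewrite -big_mkcondr; apply: eq_bigl => u; rewrite onehot_avoid.
Qed.

End Embedding.

(** The full cube restricted to one point has sum 1 or -1; this settles small [d]. *)
Lemma herdisc_subcubes_gt0 d : (0 < herdisc (subcubes d))%N.
Proof.
pose u : cube d := [ffun=> false].
have [f] := herdisc_coloring (subcubes d) [set u].
pose v : {ffun 'I_d -> option bool} := [ffun=> None].
move=> /(_ (subcube v)) fP; apply: leq_trans (fP _); last exact: imset_f.
rewrite (big_pred1 u) ?abszX ?exp1n // => w; rewrite inE andbC.
by rewrite inE; case: forallP => // -[i]; rewrite ffunE.
Qed.

Theorem lemma3p1 (R : realType) :
  exists c : R, 0 < c /\
    forall d : nat, (0 < d)%N ->
      c * 2 `^ (d%:R / 16%:R) <= (herdisc (subcubes d))%:R.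
Proof.
exists 8^-1; split=> [|d _]; first by rewrite invr_gt0.
have pow_le (n : nat) : (d <= 16 * n)%N ->
    2 `^ (d%:R / 16%:R) <= (2 ^ n)%:R :> R.
  move=> dn; rewrite natrX -powR_mulrn // ler_powR // ?ler1n //.
  by rewrite ler_pdivrMr ?ltr0n // -natrM ler_nat mulnC.
rewrite mulrC ler_pdivrMr // -natrM.
(* Below 48, [2^(d/16) <= 8], whence the constant. From 48 on, [3 (d %/ 16 + 2) < d %/ 3]. *)
have [lt_d|ge_d] := ltnP d 48.
  apply: le_trans (pow_le 3 _) _; first lia.
  rewrite ler_nat; have := herdisc_subcubes_gt0 d; lia.
apply: le_trans (pow_le (d %/ 16).+1 _) _; first lia.
have := @herdisc_subcubes_gt (d %/ 3) d _ (d %/ 16).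
rewrite ler_nat expnS; lia.
Qed.
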